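(* Let $\mathcal{K}=\{x\in\mathbb{R}^n : g_i(x)\ge 0,\ i=1,\dots,m\}$, where $g_1,\dots,g_m$ are real multivariate polynomials, be compact with non-empty interior (hence nonzero volume), let $\mathcal{B}=\{x\in\mathbb{R}^n : a_i\le x_i\le b_i,\ i=1,\dots,n\}$ be a hyperrectangle with $\mathcal{B}\supseteq\mathcal{K}$, and let $d\in\mathbb{N}$. Let $p_d^*$ be a solution of $$\min\Big\{\int_{\mathcal{B}}p(x)\,dx : p\in P_d,\ p\ge 1\text{ on }\mathcal{K},\ p\ge 0\text{ on }\mathcal{B}\Big\}$$ and let $w_d^*:=\int_{\mathcal{B}}p_d^*(x)\,dx$ be its optimal value. Then Algorithm 1 (described in the context), run with $p_d^*$, returns a sample uniformly distributed in $\mathcal{K}$. Moreover, the acceptance rate of the algorithm is $$\gamma_d=\frac{\mathrm{vol}\,\mathcal{K}}{w_d^*}.$$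
   Context: $P_d$ denotes the set of real polynomials in $n$ variables of degree at most $d$. $\mathrm{vol}$ denotes Lebesgue measure on $\mathbb{R}^n$. The uniform distribution on $\mathcal{K}$ is the one with density $\mathbb{I}_{\mathcal{K}}/\mathrm{vol}\,\mathcal{K}$, where $\mathbb{I}_{\mathcal{K}}$ is the indicator function of $\mathcal{K}$. Algorithm 1 (rejection sampling; all random draws are independent): (1) generate a random sample $\xi\in\mathcal{B}$ with density proportional to $p_d^*$ over $\mathcal{B}$, i.e. with density $p_d^*/w_d^*$ on $\mathcal{B}$; (2) if $\xi\notin\mathcal{K}$, go to step (1); (3) generate a sample $u$ uniform on $[0,1]$; (4) if $u\,p_d^*(\xi)\le 1$, return $x=\xi$; else go to step (1). The acceptance rate of the algorithm is the reciprocal of the expected number of samples $\xi$ that have to be drawn (executions of step (1)) until a sample is returned. *)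

(* Defs.v *)
From HB Require Import structures.
From mathcomp Require Import all_boot all_order all_algebra.
(* The notations of mpoly clash with those of MathComp-Analysis, and its names
   (isMeasure, for instance) must be shadowed by those of MathComp-Analysis. *)
From mathcomp Require Import -(notations) mpoly.
From mathcomp Require Import all_classical all_reals all_analysis.

Set Implicit Arguments.
Unset Strict Implicit.
Unset Printing Implicit Defensive.

Import Order.TTheory GRing.Theory Num.Theory.
Import numFieldNormedType.Exports.

Local Open Scope classical_set_scope.
Local Open Scope ring_scope.

(* R^n is represented by 'rV[R]_n, with the topology of the library and the
   product sigma-algebra, generated by the coordinates. *)
Definition matrix_display : measure_display -> measure_display.
Proof. exact. Qed.

Section measurable_matrix.
Context {d : measure_display} {T : sigmaRingType d}.
Variables m n : nat.

Definition mx_coord_sets : set (set 'M[T]_(m, n)) :=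
  \bigcup_(ij : 'I_m * 'I_n)
    preimage_set_system setT (fun M : 'M[T]_(m, n) => M ij.1 ij.2) measurable.

Let mx0 : <<s mx_coord_sets >> set0.
Proof. exact: sigma_algebra0. Qed.

Let mxC A : <<s mx_coord_sets >> A -> <<s mx_coord_sets >> (~` A).
Proof. exact: sigma_algebraC. Qed.

Let mx_bigcup (F : _^nat) : (forall i, <<s mx_coord_sets >> (F i)) ->
  <<s mx_coord_sets >> (\bigcup_i F i).
Proof. exact: sigma_algebra_bigcup. Qed.

HB.instance Definition _ := @isMeasurable.Build (matrix_display d)
  'M[T]_(m, n) <<s mx_coord_sets >> mx0 mxC mx_bigcup.

End measurable_matrix.

Section matrix_measurable_fun.
Context {d : measure_display} {T : measurableType d} {m n : nat}.

Lemma measurable_mx_coord (i : 'I_m) (j : 'I_n) :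
  measurable_fun setT (fun M : 'M[T]_(m, n) => M i j).
Proof.
move=> _ Y mY; apply: sub_sigma_algebra; exists (i, j) => //=.
by exists Y.
Qed.

Lemma measurable_fun_mx d' (S : measurableType d') (f : S -> 'M[T]_(m, n)) :
  (forall i j, measurable_fun setT (fun s => f s i j)) -> measurable_fun setT f.
Proof.
move=> mf; apply: (@measurability _ _ _ _ _ _ (@mx_coord_sets d T m n)) => //.
move=> _ [_ [[i j] _ [Y mY <-]] <-].
rewrite !setTI -comp_preimage -[X in measurable X]setTI.
exact: (mf i j measurableT).

Qed.

End matrix_measurable_fun.

Section lebesgue_rV.
Context {R : realType}.

Section rV_cons.
Variable n : nat.

Definition rV_cons (z : R * 'rV[R]_n) : 'rV[R]_n.+1 :=
  row_mx (z.1)%:M z.2 : 'rV[R]_(1 + n).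

Definition rV_uncons (x : 'rV[R]_n.+1) : R * 'rV[R]_n :=
  (x 0 0, rsubmx (x : 'rV[R]_(1 + n))).

Lemma rV_cons0 z : rV_cons z 0 ord0 = z.1.
Proof.
have -> : ord0 = lshift n (ord0 : 'I_1) by exact: val_inj.
by rewrite /rV_cons (row_mxEl z.1%:M z.2) mxE eqxx mulr1n.
Qed.

Lemma rV_consS z j : rV_cons z 0 (lift ord0 j) = z.2 0 j.
Proof.
have -> : lift ord0 j = rshift 1 j by exact: val_inj.
by rewrite /rV_cons (row_mxEr z.1%:M z.2).
Qed.

Lemma rV_consK : cancel rV_cons rV_uncons.
Proof.
move=> [t x]; rewrite /rV_uncons rV_cons0; congr pair.
by rewrite /rV_cons row_mxKr.
Qed.

Lemma measurable_rV_cons : measurable_fun setT rV_cons.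
Proof.
apply: measurable_fun_mx => i j; rewrite ord1.
case: (unliftP ord0 j) => [k|] ->.
  under eq_fun do rewrite rV_consS.
  exact: (measurableT_comp (measurable_mx_coord 0 k) measurable_snd).
under eq_fun do rewrite rV_cons0.
exact: measurable_fst.
Qed.

Lemma measurable_rV_uncons : measurable_fun setT rV_uncons.
Proof.
apply/measurable_fun_pairP; split; first exact: measurable_mx_coord.
apply: measurable_fun_mx => i j.
under eq_fun do rewrite mxE.
exact: measurable_mx_coord.
Qed.

End rV_cons.

Definition lebesgue_rV_cons n
    (mu : {sigma_finite_measure set 'rV[R]_n -> \bar R}) :
    set 'rV[R]_n.+1 -> \bar R :=
  pushforward (lebesgue_measure \x mu)%E (@rV_cons n).

Section lebesgue_rV_cons.
Variables (n : nat) (mu : {sigma_finite_measure set 'rV[R]_n -> \bar R}).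

Local Notation nu := (lebesgue_rV_cons mu).

Let nu0 : nu set0 = 0%E.
Proof. by rewrite /lebesgue_rV_cons /pushforward preimage_set0 measure0. Qed.

Let nu_ge0 A : (0 <= nu A)%E.
Proof. by rewrite /lebesgue_rV_cons /pushforward measure_ge0. Qed.

Let nu_sigma_additive : semi_sigma_additive nu.
Proof.
move=> F mF tF mUF; rewrite /lebesgue_rV_cons /pushforward preimage_bigcup.
apply: measure_semi_sigma_additive.
- by move=> i; rewrite -[X in measurable X]setTI; exact: measurable_rV_cons.
- apply/trivIsetP => i j _ _ ij; rewrite -preimage_setI.
  by move/trivIsetP : tF => -> //; rewrite preimage_set0.
- by rewrite -preimage_bigcup -[X in measurable X]setTI;
    exact: measurable_rV_cons.
Qed.

HB.instance Definition _ :=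
  isMeasure.Build _ _ _ nu nu0 nu_ge0 nu_sigma_additive.

Let nu_sigma_finite : sigma_finite setT nu.
Proof.
have /sigma_finiteP[F [TF ndF Foo]] := sigma_finiteT (@lebesgue_measure R).
have /sigma_finiteP[G [TG ndG Goo]] := sigma_finiteT mu.
have mFG k : measurable (F k `*` G k).
  by apply: measurableX; [exact: (Foo k).1|exact: (Goo k).1].
exists (fun k => @rV_uncons n @^-1` (F k `*` G k)).
  apply/esym; rewrite -subTset => x _.
  have [i _ Fi] : (\bigcup_i F i) (rV_uncons x).1 by rewrite -TF.
  have [j _ Gj] : (\bigcup_i G i) (rV_uncons x).2 by rewrite -TG.
  exists (maxn i j) => //; split.
  - by move: Fi; exact/subsetPset/ndF/leq_maxl.
  - by move: Gj; exact/subsetPset/ndG/leq_maxr.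
move=> k; split.
  rewrite -[X in measurable X]setTI.
  exact: (@measurable_rV_uncons n measurableT _ (mFG k)).
rewrite /lebesgue_rV_cons /pushforward -comp_preimage.
rewrite (_ : _ @^-1` _ = F k `*` G k); last first.
  by apply/funext => z; rewrite /preimage /mkset /comp rV_consK.
have [? ?] := Foo k; have [? ?] := Goo k.
by rewrite product_measure1E// lte_mul_pinfty// ge0_fin_numE.
Qed.

HB.instance Definition _ :=
  Measure_isSigmaFinite.Build _ _ _ nu nu_sigma_finite.

End lebesgue_rV_cons.

(* Lebesgue measure on R^n, as the iterated product of n copies of the Lebesgue
   measure on R; on R^0 it is the unit mass. *)
Fixpoint lebesgue_rV n : {sigma_finite_measure set 'rV[R]_n -> \bar R} :=
  match n with
  | 0 => @dirac _ _ (0 : 'rV[R]_0) R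
  | n'.+1 => lebesgue_rV_cons (lebesgue_rV n')
  end.

End lebesgue_rV.

Definition box {R : realType} {n : nat} (a b : 'I_n -> R) : set 'rV[R]_n :=
  [set x | forall i, a i <= x 0 i <= b i].

Lemma measurable_box {R : realType} {n : nat} (a b : 'I_n -> R) :
  measurable (box a b).
Proof.
rewrite (_ : box a b = \bigcap_(i in [set: 'I_n])
    ((fun x : 'rV[R]_n => x 0 i) @^-1` `[a i, b i])); last first.
  by apply/seteqP; split=> [x abx i _|x abx i]; rewrite ?/= ?in_itv/=;
    [exact: abx|have := abx i I; rewrite /= in_itv].
apply: fin_bigcap_measurable => [|i _]; first exact: finite_finset.
by rewrite -[X in measurable X]setTI; exact: measurable_mx_coord.
Qed.

Lemma lebesgue_rV_box {R : realType} {n : nat} (a b : 'I_n -> R) :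
  (forall i, a i <= b i) ->
  lebesgue_rV n (box a b) = (\prod_(i < n) (b i - a i))%:E.
Proof.
elim: n a b => [|n IHn] a b ab.
  by rewrite big_ord0 /= /dirac /= indicE mem_set// => -[].
pose a' i := a (lift ord0 i); pose b' i := b (lift ord0 i).
rewrite /= /lebesgue_rV_cons /pushforward.
rewrite (_ : _ @^-1` _ = `[a ord0, b ord0]%classic `*` box a' b').
  rewrite product_measure1E; [|by []|exact: measurable_box].
  have leb : lebesgue_measure `[a ord0, b ord0]%classic = (b ord0 - a ord0)%:E.
    rewrite lebesgue_measure_itv/= lte_fin; case: ltP => // ba.
    have /eqP -> : b ord0 == a ord0 by rewrite eq_le ba ab.
    by rewrite subrr.
  rewrite [X in (X * _)%E]leb IHn; last by move=> i; exact: ab.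
  by rewrite big_ord_recl EFinM.
apply/seteqP; split => [z abz|z [/= + abz] i].
  split => [|i]; first by have := abz ord0; rewrite rV_cons0 /= in_itv.
  by rewrite -rV_consS; exact: abz.
by rewrite in_itv/=; case: (unliftP ord0 i) => [j|] -> *; rewrite ?rV_cons0 ?rV_consS//; exact: abz.
Qed.

Section polynomial_program.
Context {R : realType} {n : nat}.
Local Notation poly := (mpoly n R).
Local Notation vol := (lebesgue_rV n).

Definition semialgebraic_set m (g : 'I_m -> poly) : set 'rV[R]_n :=
  [set x | forall i, 0 <= meval (x 0) (g i)].

Definition integral_over (B : set 'rV[R]_n) (p : poly) : R :=
  (\int[vol]_(x in B) meval (x 0) p)%R.

(* [msize p] is one plus the total degree of [p], and 0 for [p = 0]. *)
Definition feasible (K B : set 'rV[R]_n) (d : nat) (p : poly) : Prop :=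
  [/\ (msize p <= d.+1)%N,
      forall x, K x -> 1 <= meval (x 0) p &
      forall x, B x -> 0 <= meval (x 0) p].

Definition optimal (K B : set 'rV[R]_n) (d : nat) (p : poly) : Prop :=
  feasible K B d p /\
  forall q, feasible K B d q -> integral_over B p <= integral_over B q.

End polynomial_program.

Section laws.
Context {R : realType}.

Definition has_density {n} (law : set 'rV[R]_n -> \bar R) (f : 'rV[R]_n -> R) :=
  forall A, measurable A ->
    law A = (\int[lebesgue_rV n]_(x in A) (f x)%:E)%E.

Definition uniform_density {n} (K : set 'rV[R]_n) (x : 'rV[R]_n) : R :=
  \1_K x / fine (lebesgue_rV n K).

Context {dO : measure_display} {Omega : measurableType dO}.
Variable P : probability Omega R.

Definition uniform01 (U : {RV P >-> R}) : Prop :=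
  forall A, measurable A -> distribution P U A = uniform_prob ltr01 A.

Definition generated_by d (T : measurableType d) (X : {RV P >-> T}) :
    set (set Omega) :=
  preimage_set_system setT X measurable.

Definition mutually_independent (I : eqType) (F : I -> set (set Omega)) : Prop :=
  forall (J : seq I) (E : I -> set Omega), uniq J ->
    (forall i, i \in J -> F i (E i)) ->
    P (\bigcap_(i in [set` J]) E i) = (\prod_(i <- J) P (E i))%E.

End laws.

Section rejection_sampling.
Context {R : realType} {n : nat}.
Variables (K : set 'rV[R]_n) (p : mpoly n R).

(* Big-step semantics of the sampler: [returns s N x] says that, when the k-th
   execution of the loop body uses the draws [s k = (xi, u)], the sampler returns
   [x] after exactly [N] draws of [xi].  The component [u] of [s k] is looked at
   only if [xi] is in [K]. *)
Inductive returns : (nat -> 'rV[R]_n * R) -> nat -> 'rV[R]_n -> Prop :=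
| returns_accept s xi u :
    s 0 = (xi, u) -> K xi -> u * meval (xi 0) p <= 1 ->
    returns s 1 xi
| returns_outside s xi u N x :
    s 0 = (xi, u) -> ~ K xi ->
    returns (fun k => s k.+1) N x ->
    returns s N.+1 x
| returns_reject s xi u N x :
    s 0 = (xi, u) -> K xi -> ~ (u * meval (xi 0) p <= 1) ->
    returns (fun k => s k.+1) N x ->
    returns s N.+1 x.

(* On a given [s] there is at most one [N]; the infimum is +oo if the sampler does
   not return. *)
Definition num_draws (s : nat -> 'rV[R]_n * R) : \bar R :=
  ereal_inf [set N%:R%:E | N in [set N | exists x, returns s N x]].

Context {dO : measure_display} {Omega : measurableType dO}.
Variables (P : probability Omega R) (draws : Omega -> nat -> 'rV[R]_n * R).

(* The law of the returned sample; its total mass is the probability that the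
   sampler returns. *)
Definition output_law (A : set 'rV[R]_n) : \bar R :=
  P [set w | exists N x, returns (draws w) N x /\ A x].

Definition acceptance_rate : \bar R := ((\int[P]_w num_draws (draws w))^-1)%E.

End rejection_sampling.

Definition sampler_draws {R : realType} {n : nat} {dO : measure_display}
    {Omega : measurableType dO} (P : probability Omega R)
    (B : set 'rV[R]_n) (p : mpoly n R)
    (xi : nat -> {RV P >-> 'rV[R]_n}) (u : nat -> {RV P >-> R}) : Prop :=
  [/\ forall k, has_density (distribution P (xi k))
        (fun x => \1_B x * meval (x 0) p / integral_over B p),
      forall k, uniform01 (u k) &
      mutually_independent P (fun i : nat + nat =>
        match i with
        | inl k => generated_by (xi k)
        | inr k => generated_by (u k)
        end)].

(* Main.v *)
Require Import Defs.
From mathcomp Require Import all_boot all_order all_algebra.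
From mathcomp Require Import -(notations) mpoly.
From mathcomp Require Import all_classical all_reals all_analysis.
From mathcomp Require Import measurable_realfun.
Import Order.TTheory GRing.Theory Num.Theory.
Import numFieldNormedType.Exports.
Local Open Scope classical_set_scope.
Local Open Scope ring_scope.

(** Write w for the integral of p over B. A draw xi has density p / w on B, and,
    p being at least 1 on K, a point x of K passes the test u * p(x) <= 1 with
    probability 1 / p(x). So a single draw is accepted and lies in A with
    probability the integral of (p / w) * (1 / p) over K and A, that is
    vol(K & A) / w: among accepted draws the density is constant on K
    ([prob_accepted_in], which rests on Tonelli's theorem through
    [prob_pair_density]).

    Here w > 0 because p / w is a probability density
    ([density_normalization_gt0]). The volume of K is positive since K has an
    interior point, and finite since K is inside a box.

    The pairs (xi k, u k) are independent of one another ([pairs_independent], an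
    application of the pi-system argument [independent_of_pi_system]), and the
    sampler returns the first pair that falls in the acceptance region
    ([returnsP]). With q = vol K / w the probability of acceptance of one draw, the
    first accepted draw therefore has index k and lies in A with probability
    (1 - q) ^ k * vol(K & A) / w. Summing the geometric series gives
    vol(K & A) / vol K for the law of the output ([first_success_law]). The number
    of draws is the sum over k of the indicators that the first k draws are all
    rejected ([num_drawsE]), so its expectation is the sum of the (1 - q) ^ k,
    which is 1 / q ([expected_draws_upto_success]); the acceptance rate is its
    inverse q. *)

(** * Independence from a generating pi-system *)

Lemma bigcap_ltn_recr {T} (n : nat) (F : nat -> set T) :
  \bigcap_(i < n.+1) F i = \bigcap_(i < n) F i `&` F n.
Proof. by rewrite !bigcap_mkord big_ord_recr. Qed.

Section pi_system_independence.
Context {d0 d : measure_display} {Omega : measurableType d0}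
  {T : measurableType d} {R : realType} (P : probability Omega R).
Variables (X : nat -> Omega -> T) (G : set (set T)).

(** The product rule passes from a pi-system to the sigma-algebra it generates,
    one index at a time. With all the events but the M-th fixed, both sides of
    the rule are finite measures of the M-th event: the left one is a restriction
    of P pushed forward by X M, the right one a multiple of the law of X M. They
    agree on the pi-system by the previous step, hence everywhere. *)
Lemma independent_of_pi_system :
  (forall k, measurable_fun setT (X k)) ->
  measurable = <<s G >> -> setI_closed G -> G setT ->
  (forall C, (forall k, G (C k)) -> forall n,
    P (\bigcap_(k < n) (X k @^-1` C k)) = (\prod_(k < n) P (X k @^-1` C k))%E) ->
  forall C, (forall k, measurable (C k)) -> forall n,
    P (\bigcap_(k < n) (X k @^-1` C k)) = (\prod_(k < n) P (X k @^-1` C k))%E.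
Proof.
move=> mX GE GI GT indG.
have mXC k C : measurable C -> measurable (X k @^-1` C).
  by move=> mC; rewrite -[X in measurable X]setTI; exact: mX.
have Gm A : G A -> measurable A by rewrite GE => GA; exact: sub_sigma_algebra.
(* The events of index at least M still range over G only. *)
suff step M : forall C, (forall k, measurable (C k)) ->
    (forall k, (M <= k)%N -> G (C k)) -> forall n,
    P (\bigcap_(k < n) (X k @^-1` C k)) = (\prod_(k < n) P (X k @^-1` C k))%E.
  move=> C mC n.
  (* Only the events of index below n matter; the others may be put in G. *)
  pose C' k := if (k < n)%N then C k else setT.
  have CC' (k : 'I_n) : C k = C' k by rewrite /C' ltn_ord.
  rewrite bigcap_mkord; under eq_bigr do rewrite CC'.
  under [in RHS]eq_bigr do rewrite CC'.
  rewrite -(bigcap_mkord n (fun k => X k @^-1` C' k)); apply: (step n) => [k|k nk].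
    by rewrite /C'; case: ifP.
  by rewrite /C' ltnNge nk.
elim: M => [C _ GC n|M IHM C mC GC n]; first by apply: indG => k; exact: GC.
pose A D k := if k == M then D else C k.
have AM D : A D M = D by rewrite /A eqxx.
have mA D k : measurable D -> measurable (A D k).
  by move=> mD; rewrite /A; case: ifP.
have indA D : G D ->
    P (\bigcap_(k < n) (X k @^-1` A D k)) = (\prod_(k < n) P (X k @^-1` A D k))%E.
  move=> GD; apply: IHM => [k|k Mk]; first by apply: mA; exact: Gm.
  rewrite /A; case: eqP => // /eqP kM; apply: GC.
  by rewrite ltn_neqAle eq_sym kM.
have CA : C = A (C M) by apply/funext => k; rewrite /A; case: eqP => [->|].
have [nM|Mn] := leqP n M.
  have AT (k : 'I_n) : C k = A setT k by rewrite /A ltn_eqF// (leq_trans (ltn_ord k)).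
  rewrite bigcap_mkord; under eq_bigr do rewrite AT.
  under [in RHS]eq_bigr do rewrite AT.
  by rewrite -(bigcap_mkord n (fun k => X k @^-1` A setT k)) indA.
pose E := \big[setI/setT]_(k < n | k != Ordinal Mn) (X k @^-1` C k).
pose c := (\prod_(k < n | k != Ordinal Mn) P (X k @^-1` C k))%E.
have mE : measurable E by apply: bigsetI_measurable => k _; exact: mXC.
have capA D : \bigcap_(k < n) (X k @^-1` A D k) = X M @^-1` D `&` E.
  rewrite bigcap_mkord (bigD1 (Ordinal Mn))//= AM; congr (_ `&` _).
  by apply: eq_bigr => k kM; rewrite /A ifF//; apply/negbTE.
have prodA D : (\prod_(k < n) P (X k @^-1` A D k) = P (X M @^-1` D) * c)%E.
  rewrite (bigD1 (Ordinal Mn))//= AM; congr (_ * _)%E.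
  by apply: eq_bigr => k kM; rewrite /A ifF//; apply/negbTE.
(* The scalar of the second measure is itself a probability, as the choice
   D = setT shows; this is what makes it finite. *)
have cE : c = P E.
  have := indA _ GT; rewrite capA prodA preimage_setT setTI => ->.
  by rewrite probability_setT mul1e.
have c0 : 0 <= fine c by rewrite cE fine_ge0.
pose m1 : {measure set T -> \bar R} := pushforward (mrestr P mE) (X M).
pose m2 : {measure set T -> \bar R} :=
  mscale (NngNum c0) (pushforward P (X M)).
rewrite CA capA prodA muleC.
have := @measure_unique _ _ _ G (fun _ => setT) GE GI (fun _ => GT) _ (m1 (mX M)) (m2 (mX M)).
rewrite /m1 /m2 /= /mscale/= /mrestr /pushforward/= => /(_ _ _ _ (C M)) -> //.
- by rewrite fineK// cE fin_num_measure.
- by rewrite -subTset => x _; exists 0%N.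
- move=> D GD; have := indA _ GD; rewrite capA prodA => ->.
  by rewrite fineK 1?muleC// cE fin_num_measure.
- by move=> _; rewrite preimage_setT setTI (le_lt_trans (probability_le1 _ mE))// ltry.
Qed.

End pi_system_independence.

(** * Waiting for the first success *)

Lemma nneseries_geometric {R : realType} (c r : R) : 0 <= r < 1 ->
  (\sum_(0 <= k <oo) (c * r ^+ k)%:E = (c / (1 - r))%:E)%E.
Proof.
move=> /andP[r0 r1]; apply: cvg_lim => //.
rewrite (_ : (fun n => _) = EFin \o series (geometric c r)); last first.
  by apply/funext => n; rewrite /= /series/= sumEFin.
by apply: cvg_EFin; [near=> n|apply: cvg_geometric_series; rewrite ger0_norm].
Unshelve. all: by end_near.
Qed.

Section first_success.
Context {d0 d : measure_display} {Omega : measurableType d0}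
  {T : measurableType d} {R : realType} (P : probability Omega R).
Variables (X : nat -> Omega -> T) (S : set T) (q : R).
Hypothesis mX : forall k, measurable_fun setT (X k).
Hypothesis mS : measurable S.
Hypothesis indX : forall C, (forall k, measurable (C k)) -> forall n,
  P (\bigcap_(k < n) (X k @^-1` C k)) = (\prod_(k < n) P (X k @^-1` C k))%E.
Hypothesis PS : forall k, P (X k @^-1` S) = q%:E.
Hypothesis q0 : 0 < q.

Let mXC k C : measurable C -> measurable (X k @^-1` C).
Proof. by move=> mC; rewrite -[X in measurable X]setTI; exact: mX. Qed.

Definition no_success_before n : set Omega := \bigcap_(k < n) (X k @^-1` ~` S).

Lemma measurable_no_success_before n : measurable (no_success_before n).
Proof.
by rewrite /no_success_before bigcap_mkord; apply: bigsetI_measurable => k _;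
  apply: mXC; exact: measurableC.
Qed.

Let PSC k : P (X k @^-1` ~` S) = (1 - q)%:E.
Proof. by rewrite preimage_setC probability_setC ?PS//; exact: mXC. Qed.

Let onemq : 0 <= 1 - q < 1.
Proof.
by rewrite -lee_fin -(PSC 0) measure_ge0/= ltrBlDr ltrDl.
Qed.

(** The event of index n and the failures before it are constraints on distinct
    draws, so their probabilities multiply. *)
Lemma prob_no_success_before_then n C : measurable C ->
  P (no_success_before n `&` X n @^-1` C) = (((1 - q) ^+ n)%:E * P (X n @^-1` C))%E.
Proof.
move=> mC; pose D k := if (k < n)%N then ~` S else C.
have Dlt k : (k < n)%N -> D k = ~` S by rewrite /D => ->.
have Dn : D n = C by rewrite /D ltnn.
have mD k : measurable (D k) by rewrite /D; case: ifP => // _; exact: measurableC.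
have := indX _ mD n.+1; rewrite bigcap_ltn_recr big_ord_recr/= Dn.
rewrite (eq_bigcapr (G := fun k => X k @^-1` ~` S)) => [->|k kn]; last by rewrite Dlt.
congr (_ * _)%E.
rewrite (eq_bigr (fun=> (1 - q)%:E)) => [|k _]; last by rewrite Dlt.
by rewrite prodEFin prodr_const card_ord.
Qed.

Lemma prob_no_success_before n : P (no_success_before n) = ((1 - q) ^+ n)%:E.
Proof.
have := prob_no_success_before_then n _ measurableT.
by rewrite preimage_setT setIT probability_setT mule1.
Qed.

(** Conditioning on the success: the events that the first success occurs at time
    n and falls in C are disjoint with probabilities r * (1 - q) ^+ n, and the
    geometric series turns r into r / q. *)
Lemma first_success_law C (r : R) : measurable C ->
  (forall k, P (X k @^-1` (S `&` C)) = r%:E) ->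
  P (\bigcup_n (no_success_before n `&` X n @^-1` (S `&` C))) = (r / q)%:E.
Proof.
move=> mC PSC'; have mSC : measurable (S `&` C) by exact: measurableI.
rewrite measure_bigcup//; last 2 first.
- by move=> n _; apply: measurableI; [exact: measurable_no_success_before|exact: mXC].
- apply/trivIsetP => i j _ _; wlog ij : i j / (i < j)%N.
    move=> H; rewrite neq_ltn => /orP[] ij.
      by apply: H => //; rewrite neq_ltn ij.
    by rewrite setIC; apply: H => //; rewrite neq_ltn ij.
  by move=> _; rewrite -subset0 => w [[_ [Si _]] [Fj _]]; exact: Fj Si.
rewrite -[q in RHS](subKr 1) -nneseries_geometric//.
under eq_eseriesl do rewrite in_setT.
apply: eq_eseriesr => n _.
by rewrite /= prob_no_success_before_then// PSC' -EFinM mulrC.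
Qed.

(** The number of draws up to and including the first success is the number of
    the n such that all the draws before n fail, so the sum below is that number
    and its expectation is the geometric series of ratio 1 - q. *)
Lemma expected_draws_upto_success :
  (\int[P]_w \sum_(0 <= n <oo) (\1_(no_success_before n) w)%:E = q^-1%:E)%E.
Proof.
rewrite integral_nneseries//; last first.
  by move=> n; apply/measurable_EFinP/measurable_indicP/measurable_no_success_before.
rewrite -[q in RHS](subKr 1) -div1r -nneseries_geometric//.
apply: eq_eseriesr => n _.
rewrite integral_indic//; last exact: measurable_no_success_before.
by rewrite setIT /= prob_no_success_before mul1r.
Qed.

End first_success.

(** * Measurability and volume of semialgebraic sets *)

Section polynomial_sets.
Context {R : realType} {n : nat}.

Lemma measurable_meval (p : mpoly n R) :
  measurable_fun setT (fun x : 'rV[R]_n => meval (x 0) p).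
Proof.
under eq_fun do rewrite mevalE.
apply: measurable_sum => m; apply: measurable_funM => //.
apply: measurable_prod => i _; apply: measurable_funX.
exact: measurable_mx_coord.
Qed.

Lemma measurable_semialgebraic_set m (g : 'I_m -> mpoly n R) :
  measurable (semialgebraic_set g).
Proof.
rewrite (_ : semialgebraic_set g = \bigcap_(i in [set: 'I_m])
    [set x | 0 <= meval (x 0) (g i)]); last first.
  by apply/seteqP; split=> [x gx i _|x gx i]; [exact: gx|exact: gx i I].
apply: fin_bigcap_measurable => [|i _]; first exact: finite_finset.
by rewrite -[X in measurable X]setTI; apply: measurable_fun_le => //;
  exact: measurable_meval.
Qed.

(** An interior point is the centre of a nondegenerate cube inside K. *)
Lemma lebesgue_rV_gt0 (K : set 'rV[R]_n) : measurable K -> K° !=set0 ->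
  (0 < lebesgue_rV n K)%E.
Proof.
move=> mK [x /nbhs_ballP[e /= e0 xeK]].
(* Half of the radius, because the closed cube must fit in an open ball. *)
pose a i := x 0 i - e / 2; pose b i := x 0 i + e / 2.
have e20 : 0 < e / 2 by rewrite divr_gt0.
have abK : box a b `<=` K.
  move=> y aby; apply: xeK; split => // i j; rewrite ord1 /ball/=.
  have /andP[ay yb] := aby j; rewrite distrC.
  apply: (@le_lt_trans _ _ (e / 2)); last by rewrite ltr_pdivrMr// ltr_pMr// ltr1n.
  by rewrite ler_distl ay yb.
have : (lebesgue_rV n (box a b) <= lebesgue_rV n K)%E.
  by apply: le_measure; rewrite ?inE//; exact: measurable_box.
apply: lt_le_trans.
rewrite lebesgue_rV_box => [|i]; last by rewrite lerD2l ge0_cp// ltW.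
by rewrite lte_fin; apply: prodr_gt0 => i _; rewrite /a /b opprB addrC addrA subrK addr_gt0.
Qed.

End polynomial_sets.

(** * Executions of the sampler *)

Section acceptance.
Context {R : realType} {n : nat} (K : set 'rV[R]_n) (p : mpoly n R).

Definition acceptance_region : set ('rV[R]_n * R) :=
  [set z | K z.1 /\ z.2 * meval (z.1 0) p <= 1].

Lemma measurable_acceptance_region : measurable K -> measurable acceptance_region.
Proof.
move=> mK.
rewrite (_ : acceptance_region = (K `*` setT) `&`
    [set z : 'rV[R]_n * R | z.2 * meval (z.1 0) p <= 1]); last first.
  by apply/seteqP; split => [z [? ?]|z [[? _] ?]].
apply: measurableI; first exact: measurableX.
rewrite -[X in measurable X]setTI; apply: measurable_fun_le => //.
apply: measurable_funM; first exact: measurable_snd.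
exact: (measurableT_comp (measurable_meval p) measurable_fst).
Qed.

(** The two ways of rejecting a draw, outside K or by the test on u, are the two
    ways of leaving the acceptance region, so the sampler is a wait for the first
    draw in that region. *)
Lemma returnsP (s : nat -> 'rV[R]_n * R) N x :
  returns K p s N x <-> exists k, [/\ N = k.+1, (s k).1 = x, acceptance_region (s k) &
    forall j, (j < k)%N -> ~ acceptance_region (s j)].
Proof.
split.
  elim => {s N x} [s xi u s0 Kxi acc|s xi u N x s0 Kxi _ [k [-> sk acck rej]]
      |s xi u N x s0 Kxi acc _ [k [-> sk acck rej]]].
  - by exists 0%N; rewrite s0; split.
  - by exists k.+1; split => // -[_|j]; [rewrite s0 => -[]|exact: rej].
  - by exists k.+1; split => // -[_|j]; [rewrite s0 => -[]|exact: rej].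
move=> [k [-> {N}]]; elim: k s => [s <- [Ks acc] _|k IHk s sk acck rej].
  by apply: (@returns_accept _ _ _ _ _ _ (s 0%N).2) => //; case: (s 0%N).
have ret : returns K p (fun k => s k.+1) k.+1 x.
  by apply: IHk => // j jk; exact: (rej j.+1).
case s0 : (s 0%N) => [xi v].
have [Kxi|nKxi] := pselect (K xi); last exact: returns_outside s0 nKxi ret.
have nacc : ~ v * meval (xi 0) p <= 1.
  by move=> acc; apply: (rej 0%N) => //; rewrite s0.
exact: returns_reject s0 Kxi nacc ret.
Qed.

(** If the first accepted draw has index k, exactly the k.+1 first terms of the
    series are 1; if no draw is accepted all of them are, and both sides are
    infinite. This form makes the number of draws measurable and its expectation
    computable term by term. *)
Lemma num_drawsE (s : nat -> 'rV[R]_n * R) :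
  num_draws K p s =
  (\sum_(0 <= k <oo) (\1_[set s | forall j, (j < k)%N -> ~ acceptance_region (s j)] s)%:E)%E.
Proof.
pose rej k : set (nat -> 'rV[R]_n * R) :=
  [set s | forall j, (j < k)%N -> ~ acceptance_region (s j)].
have [[k [acck rejk]]|never] :=
    pselect (exists k, acceptance_region (s k) /\ rej k s).
  have -> : num_draws K p s = k.+1%:R%:E.
    rewrite /num_draws (_ : [set _ | _ in _] = [set k.+1%:R%:E]) ?ereal_inf1//.
    apply/seteqP; split => [_ [N [x /returnsP[l [-> _ accl rejl]]] <-]|_ ->].
      rewrite /=; suff -> : l = k by [].
      case: (ltngtP l k) => // [lk|kl].
        by case: (rejk _ lk).
      by case: (rejl _ kl).
    by exists k.+1 => //; exists (s k).1; apply/returnsP; exists k.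
  rewrite (nneseries_split 0 k.+1)//= add0n [X in (_ + X)%E]eseries0 ?adde0.
    rewrite (eq_big_nat _ _ (F2 := fun=> 1%:E)).
      by rewrite sumEFin sumr_const_nat subn0.
    move=> l /andP[_ lk]; rewrite indicE mem_set// => j jl.
    by apply: rejk; exact: leq_trans jl lk.
  move=> l kl _; rewrite indicE memNset// => rejl.
  by apply: (rejl k).
have rejs k : rej k s.
  elim: k => [//|k IHk] j; rewrite ltnS leq_eqVlt => /orP[/eqP ->|/IHk//] acc.
  by apply: never; exists k.
have -> : num_draws K p s = +oo%E.
  rewrite /num_draws (_ : [set _ | _ in _] = set0) ?ereal_inf0// -subset0.
  by move=> y [N [x /returnsP[k [_ _ acck rejk]]] _]; apply: never; exists k.
apply/esym/eqyP => A _.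
pose rejE k : \bar R := (\1_(rej k) s)%:E.
have : (\sum_(0 <= k < (Num.trunc A).+1) rejE k <= \sum_(0 <= k <oo) rejE k)%E.
  by apply: nneseries_lim_ge => k _ _; rewrite lee_fin.
apply: le_trans.
rewrite (eq_bigr (fun=> 1%:E)) => [|k _]; last by rewrite /rejE indicE mem_set.
by rewrite sumEFin lee_fin sumr_const_nat subn0 ltW// truncnS_gt.
Qed.

End acceptance.

(** * Independence of the successive pairs of draws *)

Section pair_independence.
Context {d0 d1 d2 : measure_display} {Omega : measurableType d0}
  {T1 : measurableType d1} {T2 : measurableType d2} {R : realType}
  (P : probability Omega R).
Variables (X : nat -> {RV P >-> T1}) (U : nat -> {RV P >-> T2}).
Hypothesis indXU : mutually_independent P (fun i : nat + nat =>
  match i with inl k => generated_by (X k) | inr k => generated_by (U k) end).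

Let E (A : nat -> set T1) (D : nat -> set T2) (i : nat + nat) : set Omega :=
  match i with inl k => X k @^-1` A k | inr k => U k @^-1` D k end.

Let prob_bigcap_E A D : (forall k, measurable (A k)) -> (forall k, measurable (D k)) ->
  forall J : seq (nat + nat), uniq J ->
  P (\bigcap_(i in [set` J]) E A D i) = (\prod_(i <- J) P (E A D i))%E.
Proof.
move=> mA mD J uJ; apply: indXU => // -[k|k] _.
  by exists (A k) => //; rewrite setTI.
by exists (D k) => //; rewrite setTI.
Qed.

Lemma prob_pair_setX k A D : measurable A -> measurable D ->
  P ((fun w => (X k w, U k w)) @^-1` (A `*` D)) =
  (distribution P (X k) A * distribution P (U k) D)%E.
Proof.
move=> mA mD.
have := @prob_bigcap_E (fun=> A) (fun=> D) (fun=> mA) (fun=> mD) [:: inl k; inr k] erefl.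
rewrite !big_cons big_nil mule1 => <-; congr (P _).
apply/seteqP; split => [w [/= Aw Dw] i|w /= H].
  by rewrite /= !inE => /orP[] /eqP ->.
by split; [apply: (H (inl k))|apply: (H (inr k))]; rewrite /= !inE eqxx ?orbT.
Qed.

(** Independence of all the X k and U k together gives the product rule for the
    events that constrain every pair to a measurable rectangle; rectangles form a
    pi-system generating the product sigma-algebra. *)
Lemma pairs_independent C : (forall k, measurable (C k)) -> forall n,
  P (\bigcap_(k < n) ((fun w => (X k w, U k w)) @^-1` C k)) =
  (\prod_(k < n) P ((fun w => (X k w, U k w)) @^-1` C k))%E.
Proof.
apply: (independent_of_pi_system _ _
  [set A `*` D | A in @measurable _ T1 & D in @measurable _ T2]).
- by move=> k; apply/measurable_fun_pairP; split.
- exact: measurable_prod_measurableType.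
- move=> _ _ [A mA [D mD <-]] [A' mA' [D' mD' <-]].
  by rewrite -setXI; exists (A `&` A'); [exact: measurableI|];
    exists (D `&` D') => //; exact: measurableI.
- by exists setT => //; exists setT => //; rewrite setXTT.
move=> {}C GC n.
have /choice[AD CAD] : forall k, exists AD : set T1 * set T2,
    [/\ measurable AD.1, measurable AD.2 & C k = AD.1 `*` AD.2].
  by move=> k; have [A mA [D mD <-]] := GC k; exists (A, D).
pose A k := (AD k).1; pose D k := (AD k).2.
have mA k : measurable (A k) by have [] := CAD k.
have mD k : measurable (D k) by have [] := CAD k.
have CE k : C k = A k `*` D k by have [] := CAD k.
pose J : seq (nat + nat) := map inl (iota 0 n) ++ map inr (iota 0 n).
have uJ : uniq J.
  rewrite cat_uniq !map_inj_uniq ?iota_uniq ?andbT//=; last 2 first.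
  - by move=> ? ? [].
  - by move=> ? ? [].
  by apply/hasPn => _ /mapP[k _ ->]; apply/negP => /mapP[].
rewrite [LHS](_ : _ = P (\bigcap_(i in [set` J]) E A D i)); last first.
  congr (P _); apply/seteqP; split => [w H i|w H k kn].
    rewrite /= mem_cat => /orP[] /mapP[k]; rewrite mem_iota => /= kn ->;
      by have := H _ kn; rewrite CE => -[].
  by rewrite CE; split; [apply: (H (inl k))|apply: (H (inr k))];
    rewrite /= mem_cat; apply/orP; [left|right]; apply: map_f; rewrite mem_iota.
rewrite prob_bigcap_E// big_cat/= !big_map.
have -> : iota 0 n = index_iota 0 n by rewrite /index_iota subn0.
rewrite !big_mkord -big_split/=; apply: eq_bigr => k _.
by rewrite CE prob_pair_setX.
Qed.

End pair_independence.

(** * Law of an accepted draw *)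

Section acceptance_probability.
Context {R : realType} {n : nat} {dO : measure_display} {Omega : measurableType dO}
  (P : probability Omega R).

(** The pair has the product law, so its probability is the integral over y of the
    law of X on the sections of C at y, each an integral of f against Lebesgue
    measure. Exchanging the two integrals takes f out of the inner one. Slicing at
    y first avoids integrating against the law of X itself. *)
Lemma prob_pair_density d (T : measurableType d) (X : {RV P >-> 'rV[R]_n})
    (U : {RV P >-> T}) (f : 'rV[R]_n -> R) :
  measurable_fun setT f -> (forall x, 0 <= f x) ->
  has_density (distribution P X) f ->
  (forall A D, measurable A -> measurable D ->
    P ((fun w => (X w, U w)) @^-1` (A `*` D)) =
    (distribution P X A * distribution P U D)%E) ->
  forall C, measurable C ->
  P ((fun w => (X w, U w)) @^-1` C) =
  (\int[lebesgue_rV n]_x ((f x)%:E * distribution P U (xsection C x)))%E.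
Proof.
move=> mf f0 Xf indXU C mC.
have mXU : measurable_fun setT (fun w => (X w, U w)).
  by apply/measurable_fun_pairP; split.
pose m : {measure set ('rV[R]_n * T) -> \bar R} :=
  pushforward P (fun w => (X w, U w)).
rewrite -[LHS]/(m mXU C) -(@product_measure_unique _ _ _ _ _
  (distribution P X) (distribution P U) (m mXU) indXU C mC).
rewrite (@product_measure_unique _ _ _ _ _ _ _
  (distribution P X \x^ distribution P U)%E _ _ mC); last first.
  by move=> A D mA mD; exact: product_measure2E.
pose g (z : 'rV[R]_n * T) := ((f z.1)%:E * (\1_C z)%:E)%E.
transitivity (\int[distribution P U]_y \int[lebesgue_rV n]_x g (x, y))%E.
  apply: eq_integral => y _; rewrite [LHS]Xf; last exact: measurable_ysection.
  rewrite integral_mkcond; apply: eq_integral => x _.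
  rewrite /g patchE/= indicE mem_ysection.
  by case: ifP => _; rewrite ?mule1 ?mule0.
rewrite -fubini_tonelli; last 2 first.
- apply: emeasurable_funM; last by apply/measurable_EFinP/measurable_indicP.
  by apply/measurable_EFinP; exact: (measurableT_comp mf measurable_fst).
- by move=> z; rewrite mule_ge0 ?lee_fin.
apply: eq_integral => x _; have mCx := measurable_xsection x mC.
rewrite -[xsection C x]setIT -integral_indic// -ge0_integralZl_EFin//; last first.
  by apply/measurable_EFinP/measurable_indicP.
apply: eq_integral => y _; rewrite /g !indicE/=; congr (_ * (_%:R)%:E)%E.
by apply/esym; rewrite mem_xsection.
Qed.

Lemma uniform01_mul_le1 (U : {RV P >-> R}) (t : R) : uniform01 U -> 1 <= t ->
  distribution P U [set y | y * t <= 1] = t^-1%:E.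
Proof.
move=> Uu t1; have t0 : 0 < t by exact: lt_le_trans t1.
have -> : [set y | y * t <= 1] = `]-oo, t^-1]%classic.
  by apply/seteqP; split => y /=; rewrite in_itv/= -[t^-1]div1r ler_pdivlMr.
rewrite Uu// /uniform_prob integral_uniform_pdf.
have -> : `]-oo, t^-1]%classic `&` `[0, 1]%classic = `[0, t^-1]%classic.
  apply/seteqP; split => y /=; rewrite !in_itv/=.
    by move=> [-> /andP[->]].
  move=> /andP[-> yt]; split => //=.
  by rewrite (le_trans yt)// invf_le1.
have leb : lebesgue_measure `[0, t^-1]%classic = t^-1%:E.
  by rewrite lebesgue_measure_itv/= lte_fin invr_gt0 t0 sube0.
rewrite (eq_integral (fun=> 1%:E)).
  by rewrite integral_cst// mul1e; exact: leb.
move=> y; rewrite inE/= in_itv/= => /andP[y0 yt].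
by rewrite /uniform_pdf y0 (le_trans yt) ?invf_le1//= subr0 invr1.
Qed.

Variables (K B : set 'rV[R]_n) (p : mpoly n R).
Hypothesis mB : measurable B.
Hypothesis pB : forall x, B x -> 0 <= meval (x 0) p.

(** A zero denominator would make the density vanish identically, whereas it
    integrates to 1. The value 0 that the real-valued integral takes when the
    integral diverges is excluded in the same way. *)
Lemma density_normalization_gt0 (X : {RV P >-> 'rV[R]_n}) :
  has_density (distribution P X)
    (fun x => \1_B x * meval (x 0) p / integral_over B p) ->
  0 < integral_over B p.
Proof.
move=> Xp; rewrite lt_neqAle; apply/andP; split; last first.
  by apply: Rintegral_ge0.
apply/eqP => w0; have := Xp _ measurableT; rewrite -w0 probability_setT.
under eq_integral do rewrite invr0 mulr0.
by rewrite integral0 => /eqP; rewrite onee_eq0.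
Qed.

Hypothesis mK : measurable K.
Hypothesis KB : K `<=` B.
Hypothesis pK : forall x, K x -> 1 <= meval (x 0) p.

(** At a point x of K the density is p(x) / w and the draw is accepted with
    probability 1 / p(x): the factor p(x) cancels, and the accepted draws are
    spread over K with the constant density 1 / w. *)
Lemma prob_accepted_in (X : {RV P >-> 'rV[R]_n}) (U : {RV P >-> R}) A :
  has_density (distribution P X)
    (fun x => \1_B x * meval (x 0) p / integral_over B p) ->
  uniform01 U ->
  (forall A D, measurable A -> measurable D ->
    P ((fun w => (X w, U w)) @^-1` (A `*` D)) =
    (distribution P X A * distribution P U D)%E) ->
  measurable A ->
  P ((fun w => (X w, U w)) @^-1` (acceptance_region K p `&` (A `*` setT))) =
  (lebesgue_rV n (K `&` A) * (integral_over B p)^-1%:E)%E.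
Proof.
move=> Xp Uu indXU mA; have w0 := density_normalization_gt0 _ Xp.
have mKA : measurable (K `&` A) by exact: measurableI.
rewrite (prob_pair_density _ _ _ _ _ _ _ Xp)//; last 3 first.
- apply: measurable_funM => //; apply: measurable_funM => //.
  exact: measurable_meval.
- move=> x; apply: divr_ge0; last exact: ltW.
  rewrite indicE.
  by have [/set_mem/pB ?|_] := boolP (x \in B); rewrite ?mul1r ?mul0r.
- apply: measurableI; first exact: measurable_acceptance_region.
  exact: measurableX.
rewrite (eq_integral (fun x => ((integral_over B p)^-1%:E * (\1_(K `&` A) x)%:E)%E)).
  rewrite ge0_integralZl_EFin ?invr_ge0 ?ltW//; last first.
    exact/measurable_EFinP/measurable_indicP.
  by rewrite integral_indic// setIT muleC.
move=> x _; rewrite !indicE [X in distribution P U X](_ : _ =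
  if x \in K `&` A then [set y | y * meval (x 0) p <= 1] else set0); last first.
  apply/seteqP; split => y /=; rewrite /xsection/= inE.
    by move=> [[/= Kx xy] [/= Ax _]]; rewrite mem_set.
  by case: ifPn => // /set_mem[Kx Ax] xy.
have [/set_mem[Kx Ax]|_] := boolP (x \in K `&` A); last first.
  by rewrite measure0 !mule0.
have p0 : meval (x 0) p != 0 by rewrite gt_eqF// (lt_le_trans _ (pK _ Kx)).
rewrite (mem_set (KB _ Kx)) mul1r mule1.
by rewrite uniform01_mul_le1 ?pK// -!EFinM mulrAC divff// mul1r.
Qed.

End acceptance_probability.

(** * Correctness and acceptance rate *)

Theorem theorem4 (R : realType) (n m d : nat)
  (g : 'I_m -> mpoly n R) (a b : 'I_n -> R) (p : mpoly n R)
  (K := semialgebraic_set g) (B := box a b)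
  (hKcompact : compact K) (hKinterior : K° !=set0) (hKB : K `<=` B)
  (hp : optimal K B d p) (w := integral_over B p)
  (dO : measure_display) (Omega : measurableType dO) (P : probability Omega R)
  (xi : nat -> {RV P >-> 'rV[R]_n}) (u : nat -> {RV P >-> R})
  (hdraws : sampler_draws B p xi u)
  (draws := fun (omega : Omega) (k : nat) => (xi k omega, u k omega)) :
  has_density (output_law K p P draws) (uniform_density K) /\
  acceptance_rate K p P draws = (lebesgue_rV n K / w%:E)%E.
Proof.
have [[_ pK pB] _] := hp.
have [xi_law u_law indep] := hdraws.
have mK : measurable K by exact: measurable_semialgebraic_set.
have mB : measurable B by exact: measurable_box.
have volK_gt0 : (0 < lebesgue_rV n K)%E by exact: lebesgue_rV_gt0.
(* The box has sides of nonnegative length because it contains a point of K. *)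
have volK_fin : lebesgue_rV n K \is a fin_num.
  have [x /interior_subset/hKB Bx] := hKinterior.
  rewrite ge0_fin_numE//; apply: (@le_lt_trans _ _ (lebesgue_rV n B)).
    by apply: le_measure; rewrite ?inE.
  rewrite lebesgue_rV_box ?ltry// => i.
  by have /andP[ax xb] := Bx i; exact: le_trans ax xb.
have volKA_fin A : measurable A -> lebesgue_rV n (K `&` A) \is a fin_num.
  move=> mA; rewrite ge0_fin_numE//.
  apply: (@le_lt_trans _ _ (lebesgue_rV n K)); last by rewrite ltey_eq volK_fin.
  by apply: le_measure; rewrite ?inE//; exact: measurableI.
have w0 : 0 < w by exact: (density_normalization_gt0 _ _ _ pB _ (xi_law 0%N)).
pose X k omega := draws omega k.
pose S := acceptance_region K p.
pose v A := fine (lebesgue_rV n (K `&` A)).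
have mS : measurable S by exact: measurable_acceptance_region.
have mX k : measurable_fun setT (X k) by apply/measurable_fun_pairP; split.
have accepted_in k A : measurable A ->
    P (X k @^-1` (S `&` (A `*` setT))) = (v A / w)%:E.
  move=> mA; rewrite [LHS](prob_accepted_in _ K B _ _ pB _ _ _ (xi k) (u k))//.
    by rewrite EFinM fineK// volKA_fin.
  by move=> *; exact: prob_pair_setX.
have vT : v setT = fine (lebesgue_rV n K) by rewrite /v setIT.
have accepted k : P (X k @^-1` S) = (v setT / w)%:E.
  by have := accepted_in k _ measurableT; rewrite setXTT setIT.
have v0 : 0 < v setT by rewrite vT fine_gt0// volK_gt0 ltey_eq volK_fin.
have q0 : 0 < v setT / w by rewrite divr_gt0.
have indX : forall C, (forall k, measurable (C k)) -> forall N,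
    P (\bigcap_(k < N) (X k @^-1` C k)) = (\prod_(k < N) P (X k @^-1` C k))%E.
  exact: pairs_independent.
split.
  move=> A mA; rewrite /output_law.
  have -> : [set omega | exists N x, returns K p (draws omega) N x /\ A x] =
      \bigcup_N (no_success_before X S N `&` X N @^-1` (S `&` (A `*` setT))).
    apply/seteqP; split => [omega [_ [x [/returnsP[k [_ <- acc rej]] Ax]]]|].
      by exists k => //; split.
    move=> omega [k _ [rej [acc [Ak _]]]]; exists k.+1, (xi k omega).
    by split => //; apply/returnsP; exists k.
  rewrite (first_success_law _ _ _ (v setT / w) _ _ _ _ _ _ (v A / w))//; last 2 first.
  - exact: measurableX.
  - by move=> k; exact: accepted_in.
  rewrite /uniform_density -vT.
  rewrite (eq_integral (fun x => ((v setT)^-1%:E * (\1_K x)%:E)%E)) => [|x _]; last first.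
    by rewrite mulrC EFinM.
  rewrite ge0_integralZl_EFin ?invr_ge0 ?ltW//; last first.
    exact/measurable_funTS/measurable_EFinP/measurable_indicP.
  rewrite integral_indic// -[X in (_ * X)%E]fineK -/(v A) -?EFinM; last exact: volKA_fin.
  by congr EFin; rewrite invfM invrK mulrACA mulVf ?gt_eqF// mulr1 mulrC.
rewrite /acceptance_rate.
under eq_integral do rewrite num_drawsE.
rewrite [X in X^-1%E](_ : _ = ((v setT / w)^-1)%:E).
  by rewrite !inver invr_eq0 (gt_eqF q0) (gt_eqF w0) invrK vT EFinM fineK.
exact: (expected_draws_upto_success P X S).
Qed.
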